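(* For every positive integer $D$, there exist a positive integer $k=k(D)$ and a constant $L=L(D)$ such that, for all sufficiently large $n$ (in terms of $D$), every graph $H$ on at most $n$ vertices with $\mathrm{degen}(H)\le D$ satisfies $p_k(H)\le L\,q(H)$.
   Context: Graphs are finite and simple. For a finite set $X$ and $p\in[0,1]$, $\mu_p$ is the product measure on $2^X$: $\mu_p(\{A\})=p^{|A|}(1-p)^{|X\setminus A|}$. A family $\mathcal F\subseteq 2^X$ is increasing if closed under supersets and decreasing if closed under subsets. For a decreasing family $\mathcal D\subseteq 2^X$, $\mathcal D_{(k)}:=\{D_1\cup\cdots\cup D_k: D_i\in\mathcal D\}$. For an increasing family $\mathcal I\subseteq 2^X$, the $k$-threshold $p_k(\mathcal I)$ is the infimum of the set of $p\in[0,1]$ such that for every decreasing $\mathcal D\subseteq 2^X$ with $\mu_p(\mathcal D)\ge 1-\frac1{2k}$ we have $\mathcal D_{(k)}\cap\mathcal I\neq\emptyset$. For $S\subseteq X$ let $\langle S\rangle:=\{T\subseteq X:T\supseteq S\}$. A family $\mathcal I\subseteq2^X$ is $p$-small if there is $\mathcal G\subseteq 2^X$ with $\mathcal I\subseteq\bigcup_{S\in\mathcal G}\langle S\rangle$ and $\sum_{S\in\mathcal G}\mu_p(\langle S\rangle)\le1/2$. The expectation threshold is $q(\mathcal I)=\max\{p:\mathcal I\text{ is }p\text{-small}\}$. Take $X=\binom{[n]}2$ and identify elements of $2^{\binom{[n]}2}$ with graphs on vertex set $[n]$. For a graph $H$ on at most $n$ vertices, $\mathcal I_H\subseteq 2^{\binom{[n]}2}$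 is the family of all graphs on $[n]$ having a subgraph isomorphic to $H$; $p_k(H):=p_k(\mathcal I_H)$ and $q(H):=q(\mathcal I_H)$, with the convention $p_k(H)=q(H)=0$ if $H$ has no edges. The degeneracy $\mathrm{degen}(H)$ is the smallest integer $d$ such that every nonempty subgraph of $H$ has minimum degree at most $d$; equivalently, the smallest $d$ such that the vertices of $H$ can be ordered so that every vertex has at most $d$ neighbors preceding it. *)

(* Defs.v *)
From mathcomp Require Import classical_sets cardinality reals topology.
From mathcomp Require Import normedtype realfun.
(* Last, so that set0, subsetP, etc. refer to finite sets. *)
From mathcomp Require Import all_boot all_order all_algebra.

Set Implicit Arguments.
Unset Strict Implicit.
Unset Printing Implicit Defensive.

Import Order.TTheory GRing.Theory Num.Theory numFieldNormedType.Exports.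
Local Open Scope ring_scope.

Section Families.
Variables (R : realType) (X : finType).
Implicit Types (p : R) (A S T : {set X}) (F D G I : {set {set X}}).

Definition mu p F : R := \sum_(A in F) p ^+ #|A| * (1 - p) ^+ #|~: A|.

Definition increasing_family F : Prop :=
  forall A B : {set X}, A \in F -> A \subset B -> B \in F.

Definition decreasing_family F : Prop :=
  forall A B : {set X}, A \in F -> B \subset A -> B \in F.

(* The family D_(k) of unions of k (not necessarily distinct) members of D. *)
Definition unions (k : nat) D : {set {set X}} :=
  [set \bigcup_(i < k) f i | f : {ffun 'I_k -> {set X}} in ffun_on (mem D)].

Definition threshold (k : nat) I : R :=
  inf [set p : R | 0 <= p <= 1 /\
        forall D, decreasing_family D -> 1 - (2 * k)%:R^-1 <= mu p D ->
          unions k D :&: I != set0]%classic.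

Definition upset S : {set {set X}} := [set T : {set X} | S \subset T].

Definition psmall p I : Prop :=
  exists G, I \subset \bigcup_(S in G) upset S /\
            \sum_(S in G) mu p (upset S) <= 2^-1.

(* If set0 is in I then no p is admissible; otherwise the supremum is a
   maximum, see expectation_threshold_max below. *)
Definition expectation_threshold I : R :=
  sup [set p : R | 0 <= p <= 1 /\ psmall p I]%classic.

End Families.

(* A simple graph on the vertex type V is given by its set of edges. *)
Definition edge (V : finType) := {e : {set V} | #|e| == 2}.

(* W and F are the vertex set and the edge set of a subgraph of H. *)
Definition is_subgraph (V : finType) (H : {set edge V})
    (W : {set V}) (F : {set edge V}) : bool :=
  (F \subset H) && [forall e in F, val e \subset W].

Definition degree (V : finType) (F : {set edge V}) (v : V) : nat :=
  #|[set e in F | v \in val e]|.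

Definition degen_le (V : finType) (H : {set edge V}) (d : nat) : bool :=
  [forall W : {set V}, forall F : {set edge V},
    is_subgraph H W F && (W != set0) ==> [exists v in W, (degree F v <= d)%N]].

Lemma degen_exists (V : finType) (H : {set edge V}) : exists d, degen_le H d.
Proof.
exists #|H|; apply/forallP=> W; apply/forallP=> F; apply/implyP.
case/andP=> /andP[sFH _] /set0Pn[v vW]; apply/existsP; exists v.
rewrite vW; apply: leq_trans (subset_leq_card sFH); apply: subset_leq_card.
by apply/subsetP=> e; rewrite inE => /andP[].
Qed.

Definition degen (V : finType) (H : {set edge V}) : nat := ex_minn (degen_exists H).

(* The graph (V, H) is isomorphic to the graph (W, F), with W a subset of U. *)
Definition isomorphic_to (V U : finType) (H : {set edge V})
    (W : {set U}) (F : {set edge U}) : bool :=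
  [exists f : {ffun V -> U},
    [&& injectiveb f, f @: [set: V] == W &
        [set f @: val e | e : edge V in H] == [set val e | e : edge U in F]]].

Definition copy_family (V : finType) (H : {set edge V}) (n : nat) :
    {set {set edge 'I_n}} :=
  [set G : {set edge 'I_n} | [exists W : {set 'I_n}, exists F : {set edge 'I_n},
              is_subgraph G W F && isomorphic_to H W F]].

Definition pk (R : realType) (n k : nat) (V : finType) (H : {set edge V}) : R :=
  if H == set0 then 0 else threshold R k (copy_family H n).

Definition q (R : realType) (n : nat) (V : finType) (H : {set edge V}) : R :=
  if H == set0 then 0 else expectation_threshold R (copy_family H n).

Lemma copy_family_increasing (V : finType) (H : {set edge V}) (n : nat) :
  increasing_family (copy_family H n).
Proof.
move=> A B; rewrite !inE => /existsP[W /existsP[F]].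
case/andP=> /andP[sFA FW] iso sAB; apply/existsP; exists W; apply/existsP.
by exists F; rewrite iso /is_subgraph FW (subset_trans sFA sAB).
Qed.

Lemma continuous_mu (R : realType) (X : finType) (F : {set {set X}}) :
  continuous (fun p : R => mu p F).
Proof.
move=> p; rewrite /mu; apply: cvg_big => [|A _]; first exact: add_continuous.
apply: cvgM; first exact: exprn_continuous.
apply: (@continuous_comp _ _ _ (fun p : R => 1 - p)
         (fun x : R => x ^+ #|~: A|)); last exact: exprn_continuous.
by apply: cvgB; [exact: cvg_cst | exact: cvg_id].
Qed.

Lemma expectation_threshold_max (R : realType) (X : finType)
    (I : {set {set X}}) :
  set0 \notin I ->
  0 <= expectation_threshold R I <= 1 /\
  psmall (expectation_threshold R I) I.
Proof.
move=> I0; set A := [set p : R | 0 <= p <= 1 /\ psmall p I]%classic.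
have small0 : A 0.
  rewrite /A /=; split; first by rewrite lexx ler01.
  exists I; split.
    apply/subsetP=> S SI; apply/bigcupP; exists S => //.
    by rewrite inE.
  rewrite big1 ?invr_ge0 ?ler0n // => S SI; rewrite /mu big1 // => T.
  rewrite inE => ST; rewrite expr0n cards_eq0; case: eqP => [T0|]; last by rewrite mul0r.
  by move: ST; rewrite T0 subset0 => /eqP S0; rewrite -S0 SI in I0.
have clA : topology_structure.closed A.
  pose covers (G : {set {set X}}) := I \subset \bigcup_(S in G) upset S.
  pose B (G : {set {set X}}) := ([set p : R | 0 <= p] `&` ([set p : R | p <= 1]
    `&` [set p : R | \sum_(S in G) mu p (upset S) <= 2^-1]))%classic.
  have -> : A = (\bigcup_(G in [set G | covers G]) B G)%classic.
    rewrite classical_sets.eqEsubset; split=> p /=.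
      by move=> [/andP[p0 p1] [G [IG sG]]]; exists G.
    by move=> [G IG [p0 [p1 sG]]]; split; [apply/andP | exists G].
  apply: closed_bigcup => [|G _]; first exact: finite_finset.
  apply: closedI; first exact: closed_ge.
  apply: closedI; first exact: closed_le.
  have ct : continuous (fun p : R => \sum_(S in G) mu p (upset S)).
    apply: continuous_big => [|S _]; first exact: add_continuous.
    exact: continuous_mu.
  have cl : topology_structure.closed [set x : R | x <= 2^-1]%classic.
    exact: closed_le.
  by move/continuous_closedP: ct => /(_ _ cl).
suff : A (sup A) by [].
rewrite [X in X _](_ : A = topology_structure.closure A); last first.
  by move/closure_id: clA.
apply: closure_sup; first by exists 0.
by exists 1 => p [/andP[]].
Qed.

(* Main.v *)
(* Orient each edge of a D-degenerate H towards the earlier endpoint and give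
   the at most D edges leaving a vertex distinct indices: each index class is
   a forest, and splitting it by the parity of the depth gives two star
   forests. So H is a union of boundedly many star forests, which can be
   split further until each has at most n/168 leaves.
   If each piece appears in a mu_p-random graph with probability more than
   1/2, then p_k(H) <= p, k being the number of pieces: a random copy of a
   piece then lies in D with probability more than 1 - 1/k, so for some
   permutation of the vertices all pieces of a copy of H lie in D together.
   It remains to see that a star forest F in H with few leaves appears at
   p = L q' for every q' > q(H). If H contains j disjoint stars with d leaves,
   then the copies of these stars cover the graphs containing H, so their
   expected number at q' exceeds 1/2, whence j/(8n) < (4nq'/d)^d. This makes
   the probability that a vertex has degree at least d exceed a large
   multiple of j/n, and a greedy algorithm that serves the largest possible
   star first then finds F. No logarithm is lost, because the probability
   that the j-th largest star remains unserved decays geometrically in j. *)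

Require Import Defs.
From mathcomp Require Import boolp classical_sets reals.
From mathcomp Require Import all_boot all_order all_algebra all_fingroup.
From mathcomp Require Import ring lra zify.
Set Implicit Arguments.
Unset Strict Implicit.
Unset Printing Implicit Defensive.
Import Order.TTheory GRing.Theory Num.Theory.
Local Open Scope ring_scope.

(** * The product measure *)

Section Expectation.
Variables (R : realType) (X : finType).
Implicit Types (p : R) (A B S Y : {set X}) (f g : {set X} -> R).

Definition weight p A : R := p ^+ #|A| * (1 - p) ^+ #|~: A|.

Definition expect p f : R := \sum_A weight p A * f A.

Lemma weight_ge0 p A : 0 <= p <= 1 -> 0 <= weight p A.
Proof.
by move=> /andP[p0 p1]; rewrite mulr_ge0 ?exprn_ge0 ?subr_ge0.
Qed.

Lemma weight_prod p A : weight p A = \prod_x (if x \in A then p else 1 - p).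
Proof.
rewrite (bigID (mem A)) /=; congr (_ * _).
  by rewrite (eq_bigr (fun=> p)) ?prodr_const // => x ->.
rewrite (eq_bigr (fun=> 1 - p)) => [|x /negPf->] //.
by rewrite prodr_const; congr (_ ^+ _); apply: eq_card => x; rewrite !inE.
Qed.

Lemma sum_weight p : \sum_A weight p A = 1.
Proof.
rewrite (eq_bigr _ (fun A _ => weight_prod p A)) -bigA_distr big1 //= => x _.
by rewrite subrKC.
Qed.

Lemma mu_expect p (F : {set {set X}}) :
  mu p F = expect p (fun A => (A \in F)%:R).
Proof.
rewrite /mu /expect big_mkcond /=; apply: eq_bigr => A _.
by case: (A \in F); rewrite ?mulr1 ?mulr0.
Qed.

Lemma eq_expect p f g : f =1 g -> expect p f = expect p g.
Proof. by move=> fg; apply: eq_bigr => A _; rewrite fg. Qed.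

Lemma expect_le p f g : 0 <= p <= 1 -> (forall A, f A <= g A) ->
  expect p f <= expect p g.
Proof.
by move=> hp fg; apply: ler_sum => A _; rewrite ler_wpM2l ?weight_ge0.
Qed.

Lemma expectD p f g :
  expect p (fun A => f A + g A) = expect p f + expect p g.
Proof. by rewrite -big_split; apply: eq_bigr => A _; rewrite mulrDr. Qed.

Lemma expectZ p (c : R) f : expect p (fun A => c * f A) = c * expect p f.
Proof. by rewrite [RHS]mulr_sumr; apply: eq_bigr => A _; rewrite mulrCA. Qed.

Lemma expect_cst p (c : R) : expect p (fun=> c) = c.
Proof. by rewrite /expect -mulr_suml sum_weight mul1r. Qed.

Lemma expect_sum p (I : finType) (P : pred I) (F : I -> {set X} -> R) :
  expect p (fun A => \sum_(i | P i) F i A) = \sum_(i | P i) expect p (F i).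
Proof.
rewrite [RHS]exchange_big /=; apply: eq_bigr => A _.
by rewrite mulr_sumr.
Qed.

Lemma mu_setC p (F : {set {set X}}) : mu p (~: F) = 1 - mu p F.
Proof.
apply/eqP; rewrite eq_sym subr_eq !mu_expect -expectD.
rewrite (@eq_expect _ _ (fun=> 1)) ?expect_cst // => A.
by rewrite inE; case: (A \in F); rewrite /= ?add0r ?addr0.
Qed.

(** It replaces conditioning: for independent samples [A] and [B], the coordinates in [Y] are
    exposed through [A] and the others are drawn afresh through [B]. *)
Definition mix Y A B : {set X} := (A :&: Y) :|: (B :\: Y).

Lemma weight_mix p Y A B :
  weight p (mix Y A B) * weight p (mix Y B A) = weight p A * weight p B.
Proof.
rewrite !weight_prod -!big_split /=; apply: eq_bigr => x _.
rewrite !inE; case: (x \in Y); rewrite /= !(andbT, andbF, orbF, orFb) //.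
exact: mulrC.
Qed.

(* [(A, B) -> (mix Y A B, mix Y B A)] is a weight-preserving involution. *)
Lemma expect_mix p Y f :
  expect p f = expect p (fun A => expect p (fun B => f (mix Y A B))).
Proof.
pose h (u : {set X} * {set X}) := (mix Y u.1 u.2, mix Y u.2 u.1).
have hK : involutive h.
  move=> [A B]; rewrite /h /=; congr (_, _); apply/setP=> x; rewrite !inE;
  by case: (x \in Y); rewrite /= ?andbT ?andbF ?orbF.
have -> : expect p f = \sum_A \sum_B weight p A * weight p B * f A.
  apply: eq_bigr => A _.
  by rewrite -mulr_suml -mulr_sumr sum_weight mulr1.
rewrite pair_big (reindex_inj (inv_inj hK)) /=.
under [RHS]eq_bigr do rewrite mulr_sumr.
rewrite pair_big /=; apply: eq_bigr => -[A B] _ /=.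
by rewrite weight_mix mulrA.
Qed.

Lemma mu_upset p S : mu p (upset S) = p ^+ #|S|.
Proof.
transitivity (\sum_(A : {set X}) \prod_x
    (if x \in A then p else if x \in S then 0 else 1 - p)).
  rewrite mu_expect; apply: eq_bigr => A _; rewrite inE weight_prod.
  case: (boolP (S \subset A)) => [sSA|/subsetPn[y yS yA]].
    rewrite mulr1; apply: eq_bigr => x _; case: ifP => // xA; case: ifP => // xS.
    by rewrite (subsetP sSA) in xA.
  by rewrite mulr0 (bigD1 y) //= (negPf yA) yS mul0r.
rewrite -bigA_distr (bigID (mem S)) /= [X in _ * X]big1 => [|x /negPf->].
  rewrite mulr1 (eq_bigr (fun=> p)) ?prodr_const // => x ->.
  by rewrite addr0.
by rewrite subrKC.
Qed.

Lemma expect_split p (y : X) f : expect p f =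
  p * expect p (fun A => f (y |: A)) + (1 - p) * expect p (fun A => f (A :\ y)).
Proof.
rewrite (expect_mix p [set y]).
set a := expect p (fun A => f (y |: A)); set b := expect p (fun A => f (A :\ y)).
have -> : expect p (fun A => expect p (fun B => f (mix [set y] A B))) =
          expect p (fun A => (a - b) * (A \in upset [set y])%:R + b).
  apply: eq_expect => A; rewrite inE sub1set; case: (boolP (y \in A)) => yA.
    rewrite mulr1 subrK; apply: eq_expect => B; congr f; apply/setP=> x.
    by rewrite !inE; case: eqP => [->|]; rewrite ?yA ?andbF.
  rewrite mulr0 add0r; apply: eq_expect => B; congr f; apply/setP=> x.
  by rewrite !inE; case: eqP => [->|]; rewrite ?(negPf yA) ?andbF.
rewrite expectD expectZ -mu_expect mu_upset cards1 expr1 expect_cst.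
by ring.
Qed.

End Expectation.

(** * Binomial tails *)

Section BinomialTail.
Variables (R : realType) (p : R).
Hypothesis hp : 0 <= p <= 1.

(* The probability that a binomial(M, p) variable is at least d. *)
Fixpoint tail (M d : nat) {struct M} : R :=
  if d is d'.+1 then
    if M is M'.+1 then p * tail M' d' + (1 - p) * tail M' d else 0
  else 1.

Lemma tail0 M : tail M 0 = 1. Proof. by case: M. Qed.

Lemma tailSS M d : tail M.+1 d.+1 = p * tail M d + (1 - p) * tail M d.+1.
Proof. by []. Qed.

Lemma tail_bounds M d : 0 <= tail M d <= 1.
Proof.
elim: M d => [|M IH] [|d] //=; rewrite ?lexx ?ler01 //.
have := IH d; have := IH d.+1; move: hp (tail M d) (tail M d.+1) => hp' x y.
by nra.
Qed.

Lemma tail_ge0 M d : 0 <= tail M d. Proof. by case/andP: (tail_bounds M d). Qed.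
Lemma tail_le1 M d : tail M d <= 1. Proof. by case/andP: (tail_bounds M d). Qed.

Lemma tail_antitone M d : tail M d.+1 <= tail M d.
Proof.
elim: M d => [|M IH] [|d] //.
- by rewrite tail0 tail_le1.
- rewrite !tailSS; have := IH d; have := IH d.+1; move: hp.
  by move: (tail M d) (tail M d.+1) (tail M d.+2) => x y z; nra.
Qed.

Lemma tail_leS M d : tail M d <= tail M.+1 d.
Proof.
case: d => [|d]; rewrite ?tail0 // tailSS.
have := tail_antitone M d; move: hp; move: (tail M d) (tail M d.+1) => x y.
by nra.
Qed.

Lemma tail_mono M N d : (M <= N)%N -> tail M d <= tail N d.
Proof.
move=> /subnK <-; elim: (N - M)%N => [|k IH] //.
exact: le_trans IH (tail_leS _ _).
Qed.

(** The first [M1] and the last [M2] trials are independent, and [d1] and [d2] successes in them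
    make [d1 + d2] in all. *)
Lemma tail_mul M1 d1 M2 d2 :
  tail M1 d1 * tail M2 d2 <= tail (M1 + M2) (d1 + d2).
Proof.
elim: M1 d1 => [|M1 IH] [|d1]; rewrite ?tail0 ?mul1r ?mul0r //.
- exact: tail_ge0.
- by rewrite add0n tail_mono ?leq_addl.
- rewrite !addSn !tailSS mulrDl -!mulrA -addSn.
  by case/andP: hp => p0 p1; apply: lerD; rewrite ler_wpM2l ?subr_ge0.
Qed.

Lemma tail_one s : tail s 1 = 1 - (1 - p) ^+ s.
Proof.
by elim: s => [|s IH]; rewrite ?subrr // tailSS tail0 IH exprS; ring.
Qed.

Lemma tail_exp s d : tail s 1 ^+ d <= tail (s * d) d.
Proof.
elim: d => [|d IH]; first by rewrite muln0.
rewrite exprS mulnS; apply: le_trans (tail_mul s 1 _ d).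
by rewrite ler_wpM2l ?tail_ge0.
Qed.

(* Markov's inequality for 2^(-Z), where Z is binomial(M, p). *)
Lemma tail_compl M d : 1 - tail M d <= 2 ^+ d * (1 - p / 2) ^+ M.
Proof.
have c0 : 0 <= 1 - p / 2 by move: hp; lra.
elim: M d => [|M IH] [|d].
- by rewrite tail0 subrr expr0 mulr1 ler01.
- by rewrite /= subr0 expr0 mulr1 exprn_ege1 // ler1n.
- by rewrite tail0 subrr mulr_ge0 ?exprn_ge0.
- rewrite tailSS; have := IH d; have := IH d.+1; rewrite !exprS.
  have := exprn_ge0 M c0; have : (0 : R) <= 2 ^+ d by rewrite exprn_ge0.
  move: hp; move: (tail M d) (tail M d.+1) (_ ^+ M) (_ ^+ d) => x y z t.
  move=> /andP[p0 p1] t0 z0 H1 H2.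
  have := ler_wpM2l p0 H2.
  have p1' : 0 <= 1 - p by lra.
  have := ler_wpM2l p1' H1; nra.
Qed.

(** Ties the recursion to the product measure: exposing one coordinate [e y] is one step of [tail],
    and injectivity of [e] keeps the coordinates distinct. *)
Lemma mu_tail (X I : finType) (e : I -> X) (Y : {set I}) d : injective e ->
  mu p [set A : {set X} | (d <= #|[set x in Y | e x \in A]|)%N] = tail #|Y| d.
Proof.
move=> inj_e; move: {2}#|Y| (erefl #|Y|) => M.
elim: M Y d => [|M IH] Y [|d] cardY; rewrite ?tail0.
- by rewrite mu_expect -[RHS](expect_cst X p); apply: eq_expect => A; rewrite inE.
- move/eqP: cardY; rewrite cards_eq0 => /eqP->; rewrite cards0 /= -(expect_cst X p 0).
  rewrite mu_expect; apply: eq_expect => A; rewrite inE.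
  by rewrite (_ : [set x in _ | _] = set0) ?cards0 //; apply/setP=> x; rewrite !inE.
- by rewrite mu_expect -[RHS](expect_cst X p); apply: eq_expect => A; rewrite inE.
have /set0Pn[y yY] : Y != set0 by rewrite -cards_eq0 cardY.
have cardY' : #|Y :\ y| = M by move: cardY; rewrite (cardsD1 y) yY => -[].
rewrite cardY tailSS -cardY' -!IH // !mu_expect (expect_split p (e y)).
congr (_ * _ + _ * _); apply: eq_expect => A; rewrite !inE.
  rewrite (_ : [set x in Y | e x \in e y |: A] =
              y |: [set x in Y :\ y | e x \in A]).
    by rewrite cardsU1 !inE eqxx.
  apply/setP=> x; rewrite !inE (inj_eq inj_e).
  by case: (eqVneq x y) => [->|]; rewrite /= ?yY.
congr ((_ <= _)%N%:R); apply: eq_card => x; rewrite !inE (inj_eq inj_e).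
by case: (eqVneq x y) => [->|]; rewrite /= ?andbF.
Qed.

End BinomialTail.

(** * Greedy packing of stars *)

Lemma exists_subset_card (T : finType) (S : {set T}) m : (m <= #|S|)%N ->
  exists2 S' : {set T}, S' \subset S & #|S'| = m.
Proof.
move=> hm; exists [set x in take m (enum S)].
  by apply/subsetP=> x; rewrite inE => /mem_take; rewrite mem_enum.
rewrite cardsE (card_uniqP _) ?take_uniq ?enum_uniq // size_take -cardE.
by case: ltngtP hm.
Qed.

Section StarPacking.
Variables (R : realType) (p : R) (T I B X : finType) (e : I -> B -> X).
Variable d : T -> nat.
Hypothesis hp : 0 <= p <= 1.
Hypothesis inj_e : forall i x i' x', e i x = e i' x' -> i = i' /\ x = x'.

(** Disjoint stars embedded in a bipartite graph: [e i x] is the edge from candidate center [i] to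
    leaf position [x], [g] places the centers and [N] the leaf sets. The parameter [Y] lets the
    greedy algorithm recurse on the free positions. *)
Definition packing (cs : seq I) (S : {set T}) (Y : {set B}) (A : {set X}) :=
  exists (g : T -> I) (N : T -> {set B}),
  [/\ {in S, forall c, g c \in cs}, {in S &, injective g},
      {in S, forall c, N c \subset Y /\ #|N c| = d c},
      {in S &, forall c c', c != c' -> [disjoint N c & N c']} &
      {in S, forall c, {in N c, forall x, e (g c) x \in A}}].

Lemma packing_congr (cs : seq I) S Y (A A' : {set X}) :
  {in cs, forall i x, (e i x \in A) = (e i x \in A')} ->
  packing cs S Y A -> packing cs S Y A'.
Proof.
move=> AA' [g [N [gcs g_inj NY Ndisj NA]]]; exists g, N; split=> // c cS x xN.
by rewrite -AA' ?NA ?gcs.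
Qed.

Lemma packing_behead a cs S Y A : packing cs S Y A -> packing (a :: cs) S Y A.
Proof.
move=> [g [N [gcs g_inj NY Ndisj NA]]]; exists g, N; split=> // c cS.
by rewrite inE gcs ?orbT.
Qed.

Lemma packing_cons a (cs : seq I) (S : {set T}) (Y N0 : {set B}) (A : {set X}) c0 :
  a \notin cs -> c0 \in S -> N0 \subset Y -> #|N0| = d c0 ->
  {in N0, forall x, e a x \in A} ->
  packing cs (S :\ c0) (Y :\: N0) A -> packing (a :: cs) S Y A.
Proof.
move=> acs c0S N0Y cardN0 N0A [g [N [gcs g_inj NY Ndisj NA]]].
have gD c : c \in S -> c != c0 -> g c \in cs.
  by move=> cS cc0; apply: gcs; rewrite !inE cc0.
have ND c : c \in S -> c != c0 -> N c \subset Y :\: N0 /\ #|N c| = d c.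
  by move=> cS cc0; apply: NY; rewrite !inE cc0.
have NN0 c : c \in S -> c != c0 -> [disjoint N c & N0].
  by move=> cS cc0; have [] := ND c cS cc0; rewrite subsetD => /andP[].
exists (fun c => if c == c0 then a else g c).
exists (fun c => if c == c0 then N0 else N c); split.
- move=> c cS; case: eqVneq => [_|cc0]; first by rewrite mem_head.
  by rewrite inE gD ?orbT.
- move=> c c' cS c'S; case: (eqVneq c c0) => [->|cc0];
    case: (eqVneq c' c0) => [->|c'c0] // ee.
  + by move: acs; rewrite ee gD.
  + by move: acs; rewrite -ee gD.
  + by apply: g_inj => //; rewrite !inE ?cc0 ?c'c0.
- move=> c cS; case: eqVneq => [->|cc0] //.
  by have [] := ND c cS cc0; rewrite subsetD => /andP[].
- move=> c c' cS c'S; case: (eqVneq c c0) => [->|cc0];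
    case: (eqVneq c' c0) => [_|c'c0] // cc'.
  + by rewrite disjoint_sym NN0.
  + exact: NN0.
  + by apply: Ndisj => //; rewrite !inE ?cc0 ?c'c0.
- move=> c cS x; case: eqVneq => [_|cc0]; first exact: N0A.
  by apply: NA; rewrite !inE cc0.
Qed.

Definition rank (S : {set T}) (c : T) : nat :=
  #|[set c' in S | (d c <= d c')%N]|.

Lemma rank_sub (S S' : {set T}) c : S \subset S' -> (rank S c <= rank S' c)%N.
Proof.
move=> sS; apply: subset_leq_card; apply/subsetP=> c'; rewrite !inE.
by case/andP=> /(subsetP sS)->.
Qed.

Lemma rankD1 (S : {set T}) (c c0 : T) : c0 \in S -> (d c <= d c0)%N ->
  rank S c = (rank (S :\ c0) c).+1.
Proof.
move=> c0S dcc0; rewrite /rank (cardsD1 c0) inE c0S dcc0; congr _.+1.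
by apply: eq_card => c'; rewrite !inE andbA.
Qed.

(** If [d] is injective on [S], the ranks are 1, ..., [#|S|] and this is the geometric series; ties
    only raise ranks. The induction removes a smallest star, whose rank is [#|S|]. *)
Lemma sum_exp_rank (x : R) (S : {set T}) : 0 <= x <= 1 ->
  (1 - x) * \sum_(c in S) x ^+ rank S c <= x * (1 - x ^+ #|S|).
Proof.
move=> /andP[x0 x1]; move: {2}#|S| (erefl #|S|) => m.
elim: m S => [|m IH] S cardS.
  by move/eqP: cardS; rewrite cards_eq0 => /eqP->; rewrite big_set0 cards0 subrr !mulr0.
have /set0Pn[c1 c1S] : S != set0 by rewrite -cards_eq0 cardS.
case: (arg_minnP d c1S) => c0 c0S' c0_min; have c0S : c0 \in S by [].
have cardS' : #|S :\ c0| = m by move: cardS; rewrite (cardsD1 c0) c0S => -[].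
rewrite (big_setD1 c0) //= cardS.
have -> : rank S c0 = m.+1.
  rewrite -cardS; apply: eq_card => c; rewrite inE.
  by case: (boolP (c \in S)) => // cS; rewrite c0_min.
have := IH _ cardS'; rewrite cardS'.
set u := \sum_(_ in _) _; set v := \sum_(_ in _) _ => Hu.
have vu : v <= u.
  apply: ler_sum => c _; apply: ler_wiXn2l => //.
  by rewrite rank_sub ?subsetDl.
have x1' : 0 <= 1 - x by rewrite subr_ge0.
have := ler_wpM2l x1' vu; rewrite exprS.
by move: Hu; move: (x ^+ m) => y; lra.
Qed.

(* The candidate centers [cs] are exposed one at a time, and each takes the
   star of largest size that it can still accommodate. The right-hand side is
   a potential: if a candidate can accommodate the star at [c], then the star
   that it takes is at least as large, so the rank of [c] drops by one and the
   term of [c] is halved. *)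
Lemma packing_fail (i0 : I) M (cs : seq I) (S : {set T}) (Y : {set B}) :
  uniq cs -> (M + \sum_(c in S) d c <= #|Y|)%N ->
  mu p [set A | `[< ~ packing cs S Y A >]] <=
  \sum_(c in S) 2 ^+ rank S c * (1 - tail p M (d c) / 2) ^+ size cs.
Proof.
pose rho c := 1 - tail p M (d c) / 2.
have rho0 c : 0 <= rho c.
  by have := tail_bounds hp M (d c); rewrite /rho; move: (tail _ _ _) => x; lra.
have term_ge0 (U : {set T}) t c : 0 <= 2 ^+ rank U c * rho c ^+ t.
  by rewrite mulr_ge0 ?exprn_ge0 ?ler0n.
elim: cs S Y => [|a cs IH] S Y /=.
  (* Without candidates, failure needs [S] nonempty, and then a single term, a power of 2, is
     already at least 1. *)
  move=> _ _; have [->|/set0Pn[c cS]] := eqVneq S set0.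
    rewrite big_set0 mu_expect (@eq_expect _ _ _ _ (fun=> 0)) ?expect_cst //.
    move=> A; rewrite inE; case: asboolP => // -[].
    by exists (fun=> i0), (fun=> set0); split=> // c; rewrite inE.
  apply: (@le_trans _ _ 1).
    rewrite mu_expect -[leRHS](expect_cst X p); apply: expect_le => // A.
    by rewrite lern1 leq_b1.
  rewrite (big_setD1 c) //= expr0 mulr1 -[leLHS]addr0 lerD //.
    by rewrite exprn_ege1 // ler1n.
  by apply: sumr_ge0 => c' _; rewrite mulr_ge0 // exprn_ge0 ?ler0n.
move=> /andP[acs ucs] cardY.
(* [Z] holds the edges at the candidate [a]. They are read from [A], while the edges at [cs] stay
   fresh in [A'], so the induction hypothesis applies with [A] fixed. *)
pose Z := [set e a x | x in [set: B]].
pose nb (A : {set X}) := [set x in Y | e a x \in A].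
have aZ A A' x : (e a x \in mix Z A A') = (e a x \in A).
  have -> : e a x \in mix Z A A' = [|| (e a x \in A) && true | false].
    by rewrite !inE imset_f // andbF.
  by rewrite andbT orbF.
have csZ A A' : {in cs, forall i x, (e i x \in mix Z A A') = (e i x \in A')}.
  move=> i ics x; have /negPf iZ : e i x \notin Z.
    apply/imsetP=> -[x' _ /inj_e[ia _]]; by rewrite ia (negPf acs) in ics.
  by rewrite /mix !inE iZ andbF.
pose good c A := (d c <= #|nb A|)%N.
have step A : expect p (fun A' =>
      (mix Z A A' \in [set A | `[< ~ packing (a :: cs) S Y A >]])%:R) <=
    \sum_(c in S) 2 ^+ rank S c * rho c ^+ size cs * (1 - (good c A)%:R / 2).
  have [/existsP[c1 /andP[c1S c1A]]|/existsPn noc] :=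
    boolP [exists c, (c \in S) && good c A]; last first.
    apply: le_trans (le_trans (IH S Y ucs cardY) _); last first.
      apply: ler_sum => c cS; have := noc c; rewrite cS /= => /negPf->.
      by rewrite mul0r subr0 mulr1.
    rewrite mu_expect; apply: expect_le => // A'; rewrite !inE ler_nat.
    apply: leq_trans (leqnn _); case: asboolP => // nA; case: asboolP => // -[] pA.
    apply: nA; apply: packing_behead; apply: packing_congr pA => i ics x.
    by rewrite csZ.
  have P1 : [pred c in S | good c A] c1 by rewrite /= c1S.
  case: (arg_maxnP d P1) => c0 /andP[c0S c0A] c0_max.
  have [N0 N0nb cardN0] := exists_subset_card c0A.
  have N0Y : N0 \subset Y.
    by apply: subset_trans N0nb _; apply/subsetP=> x; rewrite inE => /andP[].
  have cardY' : (M + \sum_(c in S :\ c0) d c <= #|Y :\: N0|)%N.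
    rewrite cardsD (setIidPr N0Y) cardN0.
    move: cardY; rewrite (big_setD1 c0) //= addnCA => cardY.
    by rewrite leq_subRL // (leq_trans (leq_addr _ _) cardY).
  apply: le_trans (le_trans (IH _ _ ucs cardY') _).
    rewrite mu_expect; apply: expect_le => // A'; rewrite !inE ler_nat.
    case: asboolP => // nA; case: asboolP => // -[] pA.
    apply: nA; apply: (packing_cons acs c0S N0Y cardN0).
      by move=> x /(subsetP N0nb); rewrite inE aZ => /andP[].
    by apply: packing_congr pA => i ics x; rewrite csZ.
  rewrite [leRHS](big_setD1 c0) //= -[leLHS]add0r lerD //.
    rewrite mulr_ge0 //; case: (good _ _) => /=; lra.
  apply: ler_sum => c; rewrite !inE => /andP[cc0 cS].
  have [cA|_] := boolP (good c A).
    rewrite (@rankD1 S c c0) //; last by apply: c0_max; rewrite /= cS.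
    rewrite exprS [leRHS](_ : _ = 2 ^+ rank (S :\ c0) c * rho c ^+ size cs) //=.
    by field.
  rewrite mul0r subr0 mulr1; apply: ler_wpM2r; first exact: exprn_ge0 (rho0 c).
  by apply: ler_weXn2l; rewrite ?ler1n // rank_sub ?subsetDl.
(* Averaging over [A] turns the last factor of the term of [c] into 1 minus half the probability
   that [a] can accommodate that star; since [M <= #|Y|], this is at most [rho c]. *)
rewrite mu_expect (expect_mix p Z); apply: le_trans (expect_le hp step) _.
rewrite expect_sum; apply: ler_sum => c cS.
rewrite expectZ exprSr mulrA ler_wpM2l ?term_ge0 //.
rewrite (@eq_expect _ _ _ _
    (fun A => 1 + - 2^-1 * (A \in [set A | good c A])%:R)); last first.
  by move=> A; rewrite inE; ring.
rewrite expectD expect_cst expectZ -mu_expect mu_tail //; last first.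
  by move=> x x' /inj_e[].
have /(tail_mono hp (d c)) : (M <= #|Y|)%N by apply: leq_trans (leq_addr _ _) cardY.
by rewrite /rho; move: (tail _ _ _) (tail _ _ _) => u v; lra.
Qed.

End StarPacking.

(** * Copies and thresholds *)

Lemma extend_injection (V U : finType) (P : {set V}) (h : V -> U) :
  {in P &, injective h} -> (#|V| <= #|U|)%N ->
  exists2 f : V -> U, injective f & {in P, f =1 h}.
Proof.
move=> inj_h cardVU; have [v0 _|V0] := pickP V; last first.
  by exists h => // x; have := V0 x.
pose rest := enum (~: (h @: P)).
pose f v := if v \in P then h v else nth (h v0) rest (index v (enum (~: P))).
have lt_rest v : v \notin P -> (index v (enum (~: P)) < size rest)%N.
  move=> vP; apply: (@leq_trans #|~: P|).
    by rewrite cardE index_mem mem_enum inE.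
  rewrite -cardE -(leq_add2l #|P|) cardsC -{1}(card_in_imset inj_h) cardsC.
  exact: cardVU.
have f_rest v : v \notin P -> f v \notin h @: P.
  move=> vP; rewrite /f (negPf vP) -in_setC -mem_enum.
  by rewrite mem_nth ?lt_rest.
exists f => [v w|v vP]; last by rewrite /f vP.
have [vP|vP] := boolP (v \in P); have [wP|wP] := boolP (w \in P).
- by rewrite /f vP wP; apply: inj_h.
- by move=> fvw; have := f_rest w wP; rewrite -fvw /f vP imset_f.
- by move=> fvw; have := f_rest v vP; rewrite fvw /f wP imset_f.
- rewrite /f (negPf vP) (negPf wP) => /eqP.
  rewrite nth_uniq ?lt_rest ?enum_uniq // => /eqP /(@index_inj _ v).
  by apply; rewrite mem_enum inE.
Qed.

Lemma exists_injection (V U : finType) : (#|V| <= #|U|)%N ->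
  exists f : V -> U, injective f.
Proof.
move=> cardVU; have [v0 _|V0] := pickP V; last first.
  have f (v : V) : U by have := V0 v.
  by exists f => v; have := V0 v.
have /card_gt0P[u0 _] : (0 < #|U|)%N.
  by apply: leq_trans cardVU; apply/card_gt0P; exists v0.
have inj0 : {in (set0 : {set V}) &, injective (fun=> u0)} by move=> x; rewrite inE.
by have [f] := extend_injection inj0 cardVU; exists f.
Qed.

Section EdgeImage.
Implicit Types V U W : finType.

(** Defined for arbitrary [f]: an edge collapsed by [f] has no image, since an [edge] has two ends.
    For injective [f] it is the image under [map_edge]. *)
Definition edge_image V U (f : V -> U) (F : {set edge V}) : {set edge U} :=
  [set e | [exists e' in F, val e == f @: val e']].

Lemma edge_imageP V U (f : V -> U) (F : {set edge V}) e :
  reflect (exists2 e', e' \in F & val e = f @: val e') (e \in edge_image f F).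
Proof.
rewrite inE; apply: (iffP existsP) => [[e' /andP[eF /eqP ee]]|[e' eF ee]];
by exists e'; rewrite // eF ee eqxx.
Qed.

Lemma edge_imageS V U (f : V -> U) (F F' : {set edge V}) :
  F \subset F' -> edge_image f F \subset edge_image f F'.
Proof.
move=> /subsetP sF; apply/subsetP=> e /edge_imageP[e' e'F ee].
by apply/edge_imageP; exists e' => //; apply: sF.
Qed.

Lemma card_edge_inj V U (f : V -> U) (e : edge V) :
  injective f -> #|f @: val e| == 2%N.
Proof. by move=> inj_f; rewrite card_imset // (valP e). Qed.

Definition map_edge V U (f : V -> U) (inj_f : injective f) (e : edge V) : edge U :=
  exist _ (f @: val e) (card_edge_inj e inj_f).

Lemma edge_image_comp V U W (f : V -> U) (g : U -> W) (F : {set edge V}) :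
  injective f -> edge_image g (edge_image f F) = edge_image (g \o f) F.
Proof.
move=> inj_f; apply/setP=> e; apply/edge_imageP/edge_imageP.
  move=> [e1 /edge_imageP[e2 e2F e1E] eE]; exists e2 => //.
  by rewrite eE e1E imset_comp.
move=> [e2 e2F eE]; exists (map_edge inj_f e2); last by rewrite eE imset_comp.
by apply/edge_imageP; exists e2.
Qed.

Lemma edge_image_inj V U (f : V -> U) :
  injective f -> injective (edge_image f).
Proof.
move=> inj_f; have sub F F' : edge_image f F = edge_image f F' -> F \subset F'.
  move=> eFF; apply/subsetP=> e eF.
  have : map_edge inj_f e \in edge_image f F.
    by apply/edge_imageP; exists e.
  rewrite eFF => /edge_imageP[e' e'F] /= /(imset_inj inj_f).
  by move/val_inj->.
by move=> F F' eFF; apply/eqP; rewrite eqEsubset !sub.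
Qed.

Lemma card_edge_image V U (f : V -> U) (F : {set edge V}) :
  injective f -> #|edge_image f F| = #|F|.
Proof.
move=> inj_f; have inj_h : injective (map_edge inj_f).
  by move=> e e' /(congr1 val) /= /(imset_inj inj_f)/val_inj.
rewrite -(card_imset _ inj_h); apply: eq_card => e.
apply/edge_imageP/imsetP => -[e' e'F ee]; exists e' => //.
  exact: val_inj.
by rewrite ee.
Qed.

(** Replaces subgraphs and isomorphisms by embeddings. The injection is defined on all of [V], so
    isolated vertices of [H] need room as well. *)
Lemma copy_familyP V (H : {set edge V}) n (G : {set edge 'I_n}) :
  reflect (exists2 f : V -> 'I_n, injective f & edge_image f H \subset G)
    (G \in copy_family H n).
Proof.
rewrite inE; apply: (iffP existsP) => [[W /existsP[F]]|[f inj_f sG]].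
  move=> /andP[/andP[sFG _] /existsP[f /and3P[/injectiveP inj_f _ /eqP HF]]].
  exists f => //; apply: subset_trans sFG; apply/subsetP=> e.
  move=> /edge_imageP[e' e'H ee].
  have : val e \in [set val e | e : edge 'I_n in F].
    by rewrite -HF; apply/imsetP; exists e'.
  by case/imsetP=> e1 e1F /val_inj->.
exists (f @: [set: V]); apply/existsP; exists (edge_image f H).
apply/andP; split.
  rewrite /is_subgraph sG; apply/forallP=> e; apply/implyP=> /edge_imageP[e' _ ->].
  by apply: imsetS; apply: subsetT.
apply/existsP; exists (finfun f); apply/and3P; split.
- by apply/injectiveP=> x y; rewrite !ffunE => /inj_f.
- by apply/eqP; apply: eq_imset => x; rewrite ffunE.
- apply/eqP/setP=> A; apply/imsetP/imsetP => -[e eH ->].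
    exists (map_edge inj_f e); first by apply/edge_imageP; exists e.
    by apply: eq_imset => x; rewrite ffunE.
  have /edge_imageP[e' e'H ee] := eH; exists e' => //.
  by rewrite ee; apply: eq_imset => x; rewrite ffunE.
Qed.

End EdgeImage.

Lemma mu_perm (R : realType) n (p : R) (s : 'S_n) (F : {set {set edge 'I_n}}) :
  mu p [set A | edge_image s A \in F] = mu p F.
Proof.
have inj_s := @perm_inj _ s.
rewrite !mu_expect [RHS](reindex_inj (edge_image_inj inj_s)) /=.
apply: eq_bigr => A _; rewrite inE /weight card_edge_image //; congr (_ * _ ^+ _ * _).
by apply/eqP; rewrite -(eqn_add2l #|A|) cardsC -(card_edge_image A inj_s) cardsC.
Qed.

(* If [A] contains a copy of [F i] with probability more than [1/2], then a
   uniformly random copy of [F i] lies in [D] with probability more than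
   [1 - 1/k]. Hence some permutation puts all pieces of one fixed copy of [H]
   into [D] simultaneously. *)
Lemma threshold_le (R : realType) (V P : finType) (n : nat) (p : R)
    (H : {set edge V}) (F : P -> {set edge V}) :
  0 <= p <= 1 -> (#|V| <= n)%N -> (0 < #|P|)%N ->
  H \subset \bigcup_i F i -> (forall i, 2^-1 < mu p (copy_family (F i) n)) ->
  threshold R #|P| (copy_family H n) <= p.
Proof.
move=> hp cardV P_gt0 HF muF; apply: ge_inf; first by exists 0 => x [/andP[]].
split=> // D decD muD; set k := #|P|.
have [f0 inj_f0] : exists f0 : V -> 'I_n, injective f0.
  by apply: exists_injection; rewrite card_ord.
pose miss (A : {set edge 'I_n}) := [set s : 'S_n | edge_image s A \notin D].
pose bad i := miss (edge_image f0 (F i)).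
(* A permutation [t] moves the reference copy given by [f0] onto the copy inside [A]. Since [D] is
   decreasing, [s] in [bad i] then gives [t^-1 * s] in [miss A], and this map is injective. *)
have bad_miss i A : A \in copy_family (F i) n -> (#|bad i| <= #|miss A|)%N.
  case/copy_familyP=> f inj_f sA.
  have inj_h : {in f0 @: [set: V] &, injective
      (fun x => odflt x (omap f [pick v | f0 v == x]))}.
    move=> _ _ /imsetP[v _ ->] /imsetP[w _ ->].
    case: pickP => [v' /eqP/inj_f0->|/(_ v)]; last by rewrite eqxx.
    case: pickP => [w' /eqP/inj_f0->|/(_ w)]; last by rewrite eqxx.
    by move=> /= /inj_f->.
  have [h inj_h' hE] := extend_injection inj_h (leqnn _).
  have hf v : h (f0 v) = f v.
    rewrite hE ?imset_f //; case: pickP => [v' /eqP/inj_f0->|/(_ v)] //.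
    by rewrite eqxx.
  pose t := perm inj_h'.
  rewrite -(card_imset _ (mulgI (t^-1)%g)); apply: subset_leq_card.
  apply/subsetP=> _ /imsetP[s sbad ->]; rewrite !inE in sbad *.
  apply: contra sbad => /decD; apply; rewrite edge_image_comp //.
  apply: subset_trans (edge_imageS _ sA); rewrite edge_image_comp //.
  suff -> : edge_image ((t^-1 * s)%g \o f) (F i) = edge_image (s \o f0) (F i) by [].
  apply/setP=> e; rewrite !inE; apply: eq_existsb => e'.
  congr (_ && (_ == _)); apply: eq_imset => v /=.
  by rewrite permM -hf -(permE inj_h') permK.
have bad_small i : (#|bad i| * k < n`!)%N.
  (* Double counting: the mean of [#|miss A|] over random [A] is n! times the measure of the
     complement of [D], hence at most n!/(2k), and it is at least [#|bad i|] times the probability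
     of a copy of [F i]. *)
  have key : #|bad i|%:R * mu p (copy_family (F i) n) <=
             n`!%:R * (2 * k)%:R^-1 :> R.
    have -> : n`!%:R * (2 * k)%:R^-1 = \sum_(s : 'S_n) (2 * k)%:R^-1 :> R.
      by rewrite sumr_const card_Sn mulr_natl.
    apply: (@le_trans _ _ (\sum_(s : 'S_n) mu p (~: D))); last first.
      by apply: ler_sum => s _; rewrite mu_setC; move: muD; rewrite -/k; lra.
    rewrite -(eq_bigr _ (fun s _ => mu_perm p s _)).
    under eq_bigr do rewrite mu_expect.
    rewrite -expect_sum mu_expect -expectZ; apply: expect_le => // A.
    rewrite -natr_sum -natrM ler_nat.
    case: (boolP (A \in _)) => [/bad_miss hA|_]; last by rewrite muln0.
    rewrite muln1; apply: leq_trans hA _; rewrite -sum1_card big_mkcond /=.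
    by apply: leq_sum => s _; rewrite !inE; case: (_ \in _).
  have k0 : (0 : R) < k%:R by rewrite ltr0n.
  move: key; rewrite natrM invfM mulrA => key.
  rewrite -(ltr_nat R) natrM; have := muF i.
  have: (0 : R) < n`!%:R by rewrite ltr0n fact_gt0.
  have: (0 : R) <= #|bad i|%:R by rewrite ler0n.
  move: key; rewrite ler_pdivlMr //.
  move: (mu _ _) (k%:R) k0 (#|_|%:R) (n`!%:R) => m K K0 b N; nra.
have [s sgood] : exists s, s \notin \bigcup_i bad i.
  apply/existsP; rewrite -negb_forall; apply/negP=> /forallP all_bad.
  have : (#|\bigcup_i bad i| <= \sum_i #|bad i|)%N.
    elim/big_rec2: _ => [|i m B _ hB]; first by rewrite cards0.
    by rewrite (leq_trans (leq_card_setU _ _)) // leq_add2l.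
  have -> : #|\bigcup_i bad i| = n`!.
    by rewrite -card_Sn; apply: eq_card => s; rewrite all_bad.
  rewrite -(leq_pmul2r P_gt0) big_distrl /= => hle.
  have hsum : (\sum_i #|bad i| * k <= \sum_(i : P) n`!.-1)%N.
    by apply: leq_sum => i _; rewrite -ltnS prednK ?fact_gt0 // bad_small.
  move: (leq_trans hle hsum); rewrite sum_nat_const mulnC leq_pmul2l //.
  by rewrite leqNgt prednK ?fact_gt0 ?leqnn.
have inD i : edge_image s (edge_image f0 (F i)) \in D.
  apply/negPn/negP=> nD; case/bigcupP: sgood; exists i => //.
  by rewrite inE.
pose f := [ffun j : 'I_k => edge_image s (edge_image f0 (F (enum_val j)))].
apply/set0Pn; exists (\bigcup_(j < k) f j); rewrite inE; apply/andP; split.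
  by apply/imsetP; exists f => //; apply/ffun_onP=> j; rewrite ffunE inD.
apply/copy_familyP; exists (s \o f0).
  exact: inj_comp perm_inj inj_f0.
rewrite -edge_image_comp //; apply/subsetP=> e /edge_imageP[e1 /edge_imageP[e2 e2H e1E] eE].
have /bigcupP[i _ e2F] := subsetP HF e2 e2H.
apply/bigcupP; exists (enum_rank i) => //; rewrite ffunE enum_rankK.
by apply/edge_imageP; exists e1 => //; apply/edge_imageP; exists e2.
Qed.

(** * Star forests *)

Section StarForests.
Variable V : finType.
Implicit Types (phi : V -> option V) (H : {set edge V}).

(* A star forest is given by the partial function [phi] that sends each leaf
   to the center of its star. *)
Definition star_map phi := forall v u, phi v = Some u -> phi u = None.

Definition star_edges phi : {set edge V} :=
  [set e | [exists v, exists u, (phi v == Some u) && (val e == [set v; u])]].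

Definition fiber phi (c : V) : {set V} := [set v | phi v == Some c].

Lemma star_edgesP phi (e : edge V) :
  reflect (exists v u, phi v = Some u /\ val e = [set v; u])
    (e \in star_edges phi).
Proof.
rewrite inE; apply: (iffP existsP) => [[v /existsP[u /andP[/eqP ? /eqP ?]]]|].
  by exists v, u.
by move=> [v [u [vu ee]]]; exists v; apply/existsP; exists u; rewrite vu ee !eqxx.
Qed.

(* By removal of a vertex of minimum degree: its edges to the remaining graph
   get distinct indices [i], and for each [i] it takes the opposite of the
   parity of its [i]-th neighbour. *)
Lemma degenerate_decomposition H (D : nat) : (degen H <= D)%N ->
  exists (pi : 'I_D -> V -> option V) (par : 'I_D -> V -> bool),
  [/\ forall i v u, pi i v = Some u -> par i u = ~~ par i v,
      forall i v u, pi i v = Some u -> exists2 e, e \in H & val e = [set v; u] &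
      forall e, e \in H ->
        exists i v u, pi i v = Some u /\ val e = [set v; u]].
Proof.
rewrite /degen; case: ex_minnP => D' degH _ leD.
(* The induction runs over vertex sets. Keeping sources and targets in [W] ensures that no arrow
   points to a vertex added later. *)
suff step m (W : {set V}) : #|W| = m ->
    exists (pi : 'I_D -> V -> option V) (par : 'I_D -> V -> bool),
    [/\ forall i v u, pi i v = Some u ->
          [/\ par i u = ~~ par i v, v \in W & u \in W],
        forall i v u, pi i v = Some u -> exists2 e, e \in H & val e = [set v; u] &
        forall e, e \in H -> val e \subset W ->
          exists i v u, pi i v = Some u /\ val e = [set v; u]].
  have [pi [par [piP piH Hpi]]] := step _ [set: V] erefl.
  exists pi, par; split=> // [i v u /piP[]|e eH] //.
  by apply: Hpi => //; apply: subsetT.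
elim: m W => [|m IH] W cardW.
  exists (fun _ _ => None), (fun _ _ => false); split=> // e eH.
  move/eqP: cardW; rewrite cards_eq0 => /eqP->; rewrite subset0 => /eqP e0.
  by have := valP e; rewrite e0 cards0.
pose F := [set e in H | val e \subset W].
have W0 : W != set0 by rewrite -cards_eq0 cardW.
have FW : is_subgraph H W F.
  apply/andP; split; first by apply/subsetP=> e; rewrite inE => /andP[].
  by apply/forallP=> e; apply/implyP; rewrite inE => /andP[].
move/forallP/(_ W)/forallP/(_ F)/implyP: degH; rewrite FW W0 => /(_ isT).
case/existsP=> v /andP[vW deg_v].
have cardW' : #|W :\ v| = m by move: cardW; rewrite (cardsD1 v) vW => -[].
have [pi [par [piP piH Hpi]]] := IH _ cardW'.
pose other (e : edge V) := [pick u in val e | u != v].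
pose us := pmap other (enum [set e in F | v \in val e]).
have size_us : (size us <= D)%N.
  rewrite size_pmap (leq_trans (count_size _ _)) // -cardE.
  exact: leq_trans deg_v leD.
have otherP (e : edge V) u : v \in val e -> other e = Some u ->
    [/\ u != v, u \in val e & val e = [set v; u]].
  rewrite /other; case: pickP => // u' /andP[u'e u'v] ve [<-]; split=> //.
  apply/eqP; rewrite eq_sym eqEcard cards2 (eqP (valP e)) eq_sym u'v andbT.
  by apply/subsetP=> x; rewrite !inE => /orP[]/eqP->.
have usP u : u \in us ->
    [/\ u \in W, u != v & exists2 e, e \in H & val e = [set v; u]].
  rewrite mem_pmap => /mapP[e]; rewrite mem_enum !inE => /andP[/andP[eH eW] ve].
  move/esym/(otherP _ _ ve) => [uv ue ee]; split=> //; last by exists e.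
  exact: (subsetP eW).
pose pi' (i : 'I_D) w :=
  if w == v then if (i < size us)%N then Some (nth v us i) else None else pi i w.
(* No arrow enters [v], so its parity can be chosen for each [i] separately. Past the end of [us],
   [nth] gives its default and [pi'] is [None]. *)
pose par' (i : 'I_D) w :=
  if w == v then ~~ par i (nth v us i) else par i w.
exists pi', par'; split.
- move=> i w u; rewrite /pi' /par'; case: (eqVneq w v) => [->|wv].
    case: ifP => // lti [<-]; have [uW uv _] := usP _ (mem_nth v lti).
    by rewrite (negPf uv) negbK.
  move=> /piP[parE]; rewrite !inE => /andP[_ wW] /andP[uv uW].
  by rewrite (negPf uv).
- move=> i w u; rewrite /pi'; case: (eqVneq w v) => [->|_]; last exact: piH.
  by case: ifP => // lti [<-]; have [] := usP _ (mem_nth v lti).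
- move=> e eH eW; have [ve|ve] := boolP (v \in val e); last first.
    have [|i [w [u [piw ee]]]] := Hpi e eH; first by rewrite subsetD1 eW.
    exists i, w, u; rewrite /pi'; have [_] := piP _ _ _ piw.
    by rewrite !inE => /andP[/negPf->].
  have [u oe] : exists u, other e = Some u.
    rewrite /other; case: pickP => [u _|no]; first by exists u.
    have : val e \subset [set v].
      apply/subsetP=> x xe; rewrite inE; have := no x.
      by rewrite /= xe /= => /negbFE.
    by move/subset_leq_card; rewrite (eqP (valP e)) cards1.
  have [uv ue ee] := otherP _ _ ve oe.
  have uus : u \in us.
    rewrite mem_pmap; apply/mapP; exists e => //.
    by rewrite mem_enum !inE eH eW.
  have ltu : (index u us < size us)%N by rewrite index_mem.
  exists (Ordinal (leq_trans ltu size_us)), v, u.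
  by rewrite /pi' eqxx /= ltu nth_index.
Qed.

(** This is C(n,m) <= (4n/m)^m without division. The chain m^m <= C(2m,m) m! <= 4^m m! takes the
    place of Stirling's formula. *)
Lemma leq_bin_exp n m : ('C(n, m) * m ^ m <= (4 * n) ^ m)%N.
Proof.
have h1 : (m ^ m <= (m + m) ^_ m)%N.
  suff h i : (i <= m)%N -> (m ^ i <= (m + m) ^_ i)%N by exact: h.
  elim: i => [_|i IH im]; first by rewrite expn0 ffactn0.
  rewrite expnSr ffactnSr; apply: leq_mul; first exact: IH (ltnW im).
  by rewrite -addnBA ?leq_addr // ltnW.
have h2 : ((m + m) ^_ m <= 4 ^ m * m`!)%N.
  rewrite -bin_ffact leq_mul2r; apply/orP; right.
  have -> : (4 ^ m = 2 ^ (m + m))%N by rewrite addnn -mul2n expnM.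
  rewrite -[2%N]/(1 + 1)%N expnDn.
  have lem : (m < (m + m).+1)%N by rewrite ltnS leq_addr.
  by rewrite (bigD1 (Ordinal lem)) //= !exp1n !muln1 leq_addr.
have h3 : (n ^_ m <= n ^ m)%N.
  elim: m {h1 h2} => [|i IH]; first by rewrite expn0 ffactn0.
  by rewrite expnSr ffactnSr; apply: leq_mul; rewrite ?leq_subr.
rewrite expnMn; apply: leq_trans (leq_mul (leqnn _) (leq_trans h1 h2)) _.
by rewrite mulnCA leq_mul2l bin_ffact h3 orbT.
Qed.

(** * Counting star systems below the expectation threshold *)

Section ExpectationThresholdBound.
Variables (R : realType) (phi : V -> option V) (H : {set edge V}).
Variables (n d : nat) (C : {set V}) (q' : R).
Hypothesis star_phi : star_map phi.
Hypothesis phiH : star_edges phi \subset H.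
Hypothesis dC : {in C, forall c, (d <= #|fiber phi c|)%N}.
Hypothesis hq' : 0 <= q' <= 1.
Hypothesis not_small : ~ psmall q' (copy_family H n).

Definition stars (C' : {set 'I_n}) (N : {ffun 'I_n -> {set 'I_n}}) :
    {set edge 'I_n} :=
  [set e | [exists c in C', exists x in N c, val e == [set c; x]]].

(** The default [set0] in [pffun_on] makes the leaf sets empty off the centers, so that the number
    of systems is a product of binomial coefficients. *)
Definition star_systems : {set {set 'I_n} * {ffun 'I_n -> {set 'I_n}}} :=
  [set u : {set 'I_n} * {ffun 'I_n -> {set 'I_n}} | (#|u.1| == #|C|) &&
     (u.2 \in pffun_on set0 (mem u.1) [set A : {set 'I_n} | #|A| == d])].

Lemma card_star_systems : #|star_systems| = ('C(n, #|C|) * 'C(n, d) ^ #|C|)%N.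
Proof.
rewrite -sum1dep_card -(pair_big_dep (fun A : {set 'I_n} => #|A| == #|C|)
  (fun A N => N \in pffun_on set0 (mem A) [set A : {set 'I_n} | #|A| == d])
  (fun _ _ => 1%N)) /=.
rewrite (eq_bigr (fun=> 'C(n, d) ^ #|C|)%N) => [|A /eqP cardA].
  rewrite sum_nat_const; congr (_ * _)%N.
  rewrite -[in RHS](card_ord n) -card_draws.
  by apply: eq_card => A; rewrite inE.
by rewrite sum1_card card_pffun_on cardA card_draws card_ord.
Qed.

Lemma copy_contains_stars A : A \in copy_family H n ->
  exists u, [/\ u \in star_systems, stars u.1 u.2 \subset A &
              (d * #|C| <= #|stars u.1 u.2|)%N].
Proof.
case/copy_familyP=> f inj_f sA.
have /boolp.choice[L LP] : forall c : V, exists S : {set V},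
    c \in C -> S \subset fiber phi c /\ #|S| = d.
  move=> c; have [cC|_] := boolP (c \in C); last by exists set0.
  by have [S sS cardS] := exists_subset_card (dC cC); exists S.
have Lphi c x : c \in C -> x \in L c -> phi x = Some c.
  by move=> /LP[sL _] /(subsetP sL); rewrite inE => /eqP.
pose N := [ffun c' => [set x | [exists c in C, (c' == f c) && (x \in f @: L c)]]].
have NE c : c \in C -> N (f c) = f @: L c.
  move=> cC; apply/setP=> x; rewrite ffunE inE; apply/existsP/idP.
    by move=> [c' /and3P[_ /eqP/inj_f->]].
  by move=> xL; exists c; rewrite cC eqxx.
pose E := [set e : edge V | [exists c in C, exists x in L c, val e == [set c; x]]].
have starsE : stars (f @: C) N = edge_image f E.
  apply/setP=> e; rewrite inE; apply/existsP/edge_imageP.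
    move=> [_ /andP[/imsetP[c cC ->] /existsP[y /andP[]]]].
    rewrite NE // => /imsetP[x xL ->] /eqP ee.
    have cx : #|[set c; x]| == 2%N.
      rewrite cards2; suff -> : c != x by [].
      apply: contra_eq_neq (star_phi (Lphi _ _ cC xL)) => ->.
      by rewrite (Lphi _ _ cC xL).
    exists (exist _ [set c; x] cx); last by rewrite ee /= imsetU1 imset_set1.
    rewrite inE; apply/existsP; exists c; rewrite cC.
    by apply/existsP; exists x; rewrite xL /=.
  move=> [e']; rewrite inE => /existsP[c /andP[cC /existsP[x /andP[xL /eqP e'E]]]] ee.
  exists (f c); rewrite imset_f //=; apply/existsP; exists (f x).
  by rewrite NE // imset_f //= ee e'E imsetU1 imset_set1.
exists (f @: C, N); split=> /=.
- rewrite inE /= card_imset // eqxx; apply/pffun_onP; split.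
    apply/subsetP=> c'; rewrite inE; apply: contraR => c'C.
    apply/eqP/setP=> x; rewrite ffunE !inE; apply/existsP=> -[c /and3P[cC /eqP c'E _]].
    by case/negP: c'C; rewrite c'E; apply: imset_f.
  move=> _ /imageP[_ /imsetP[c cC ->] ->].
  by rewrite inE NE // card_imset //; have [_ ->] := LP c cC.
- rewrite starsE; apply: subset_trans sA; apply: edge_imageS.
  apply: subset_trans phiH; apply/subsetP=> e; rewrite inE.
  case/existsP=> c /andP[cC /existsP[x /andP[xL /eqP ee]]].
  by apply/star_edgesP; exists x, c; rewrite (Lphi c) // ee setUC.
rewrite starsE card_edge_image //.
pose LL := [set v | [exists c in C, v \in L c]].
(* An edge of [E] has exactly one end where [phi] is defined, its leaf. Hence [leaf] reaches all of
   [LL], and [E] has at least [#|LL|] edges. *)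
pose leaf (e : edge V) := [pick v in val e | phi v].
have cardLL : (d * #|C| <= #|LL|)%N.
  have h v : v \in LL -> odflt v (phi v) \in C.
    rewrite inE => /existsP[c /andP[cC vL]].
    by rewrite (Lphi c).
  rewrite -[#|LL|]sum1_card (partition_big _ _ h) /= mulnC -sum_nat_const.
  apply: leq_sum => c cC; have [_ <-] := LP c cC.
  rewrite sum1dep_card; apply: subset_leq_card; apply/subsetP=> v vL.
  rewrite !inE (Lphi c) // eqxx andbT; apply/existsP; exists c.
  by rewrite cC.
apply: leq_trans cardLL _.
have inj_Some : injective (@Some V) by move=> x y [].
rewrite -(card_imset LL inj_Some).
apply: leq_trans (leq_imset_card leaf E); apply: subset_leq_card.
apply/subsetP=> _ /imsetP[v vLL ->]; move: vLL.
rewrite inE => /existsP[c /andP[cC vL]]; have phiv := Lphi _ _ cC vL.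
have phic := star_phi phiv.
have cv : #|[set c; v]| == 2%N.
  rewrite cards2; suff -> : c != v by [].
  by apply: contra_eq_neq phic => ->; rewrite phiv.
apply/imsetP; exists (exist _ [set c; v] cv).
  by rewrite inE; apply/existsP; exists c; rewrite cC; apply/existsP; exists v; rewrite vL /=.
rewrite /leaf /=; case: pickP => [w|/(_ v)]; last by rewrite !inE eqxx orbT phiv.
by rewrite !inE => /andP[/orP[]/eqP->] //; rewrite phic.
Qed.

(* The copies of [#|C|] disjoint stars with [d] leaves cover [copy_family H n]. *)
Lemma expectation_bound :
  2^-1 < ('C(n, #|C|) * 'C(n, d) ^ #|C|)%:R * q' ^+ (d * #|C|).
Proof.
rewrite ltNge; apply/negP=> small; apply: not_small.
(* Systems whose edges coincide or degenerate are left out: with fewer than [d * #|C|] edges, their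
   up-sets could be too likely. *)
pose G := [set stars u.1 u.2 | u in star_systems & (d * #|C| <= #|stars u.1 u.2|)%N].
exists G; split.
  apply/subsetP=> A /copy_contains_stars[u [uS uA cardu]].
  apply/bigcupP; exists (stars u.1 u.2); last by rewrite inE.
  by apply/imsetP; exists u; rewrite // inE uS.
apply: le_trans small; rewrite -card_star_systems.
apply: (@le_trans _ _ (\sum_(S in G) q' ^+ (d * #|C|))).
  apply: ler_sum => S /imsetP[u]; rewrite inE => /andP[_ cardu] ->.
  by rewrite mu_upset; case/andP: hq' => q0 q1; apply: ler_wiXn2l.
rewrite sumr_const -[leLHS]mulr_natl ler_wpM2r ?exprn_ge0 //; first by case/andP: hq'.
rewrite ler_nat.
apply: leq_trans (leq_imset_card _ _) _; apply: subset_leq_card.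
by apply/subsetP=> u; rewrite inE => /andP[].
Qed.

End ExpectationThresholdBound.

End StarForests.

(** * Numerical estimates *)

Section Estimates.
Variable R : realType.
Implicit Types (p x : R) (n M d j s t : nat).

(** The bound (1 - x)^s <= 1/(1 + sx) serves as an algebraic substitute for exp(-sx). *)
Lemma bernoulli_inv x s : 0 <= x <= 1 -> (1 - x) ^+ s * (1 + s%:R * x) <= 1.
Proof.
move=> /andP[x0 x1]; elim: s => [|s IH].
  by rewrite expr0 mul0r addr0 mul1r.
apply: le_trans IH; rewrite exprSr -mulrA ler_wpM2l ?exprn_ge0 ?subr_ge0 //.
rewrite -natr1; have : (0 : R) <= s%:R by rewrite ler0n.
by move: (s%:R) => S S0; nra.
Qed.

Lemma exp_compl_le x (c : R) s t m : 0 <= x <= 1 -> 0 < c -> (s * m <= t)%N ->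
  c <= 1 + s%:R * x -> (1 - x) ^+ t <= (c^-1) ^+ m.
Proof.
move=> hx c0 smt hc; have /andP[x0 x1] := hx.
have y0 : 0 <= 1 - x by rewrite subr_ge0.
have y1 : 1 - x <= 1 by rewrite gerBl.
apply: (@le_trans _ _ ((1 - x) ^+ (s * m))); first exact: ler_wiXn2l.
rewrite exprM lerXn2r ?nnegrE ?exprn_ge0 ?invr_ge0 ?(ltW c0) //.
rewrite -[leRHS]mul1r ler_pdivlMr //.
apply: le_trans (bernoulli_inv s hx).
by rewrite ler_wpM2l ?exprn_ge0.
Qed.

Lemma bin_le_exp n m : (0 < m)%N ->
  'C(n, m)%:R <= (4 * n%:R / m%:R) ^+ m :> R.
Proof.
move=> m0; rewrite expr_div_n ler_pdivlMr ?exprn_gt0 ?ltr0n //.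
by rewrite -natrM -!natrX -natrM ler_nat leq_bin_exp.
Qed.

(** Extracts a [j]-th root: with [Y] = (4n/j) [Z], the hypothesis gives [Y ^+ j] > 1/2. This forces
    [Y] > 1/2, as powers of a number in [0, 1/2] do not exceed it. *)
Lemma expectation_bound_le n d j (q' : R) : (0 < n)%N -> (0 < d)%N -> (0 < j)%N ->
  0 <= q' -> 2^-1 < ('C(n, j) * 'C(n, d) ^ j)%:R * q' ^+ (d * j) ->
  j%:R / (8 * n%:R) < (4 * n%:R * q' / d%:R) ^+ d.
Proof.
move=> n0 d0 j0 q0 lb.
set Z := (4 * n%:R * q' / d%:R) ^+ d.
have n0' : (0 : R) < n%:R by rewrite ltr0n.
have j0' : (0 : R) < j%:R by rewrite ltr0n.
have Z0 : 0 <= Z by rewrite exprn_ge0 // !mulr_ge0 ?invr_ge0 ?ler0n.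
pose Y := 4 * n%:R / j%:R * Z.
have Y0 : 0 <= Y by rewrite !mulr_ge0 ?invr_ge0 ?ler0n.
have lbY : 2^-1 < Y ^+ j.
  apply: lt_le_trans lb _.
  have -> : Y ^+ j = (4 * n%:R / j%:R) ^+ j * ((4 * n%:R / d%:R) ^+ d) ^+ j
                     * q' ^+ (d * j).
    have ZE : Z = (4 * n%:R / d%:R) ^+ d * q' ^+ d by rewrite -exprMn mulrAC.
    by rewrite /Y ZE mulrA [_ ^+ (d * j)]exprM -2!exprMn.
  rewrite ler_wpM2r ?exprn_ge0 // natrM natrX.
  apply: ler_pM; rewrite ?exprn_ge0 ?ler0n ?bin_le_exp //.
  by rewrite lerXn2r ?nnegrE ?exprn_ge0 ?mulr_ge0 ?invr_ge0 ?ler0n ?bin_le_exp.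
have Yhalf : 2^-1 < Y.
  rewrite ltNge; apply/negP=> Yle; have : Y ^+ j <= Y ^+ 1.
    by apply: ler_wiXn2l => //; lra.
  by rewrite expr1; move: lbY Yle; move: (Y ^+ j) => u; lra.
rewrite ltr_pdivrMr ?mulr_gt0 //.
move: Yhalf; rewrite /Y mulrAC ltr_pdivlMr //; lra.
Qed.

Lemma tail_lower p (q' : R) n M d j : 0 <= p <= 1 -> 0 <= q' -> p = 448 * 336 * q' ->
  (0 < d)%N -> (168 * d <= n)%N -> (n <= 4 * M)%N -> (168 * j <= n)%N ->
  j%:R / (8 * n%:R) < (4 * n%:R * q' / d%:R) ^+ d ->
  84 * j%:R / n%:R <= tail p M d.
Proof.
move=> hp q0 pE d0 dn nM jn lb; have /andP[p0 p1] := hp.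
have n0 : (0 < n)%N by lia.
have n0' : (0 : R) < n%:R by rewrite ltr0n.
have d0' : (0 : R) < d%:R by rewrite ltr0n.
pose s := (M %/ d)%N.
have sdM : (s * d <= M)%N by apply: leq_divM.
have nsd : (n <= 8 * (s * d))%N.
  have : (M < (s + 1) * d)%N by rewrite addn1 ltn_ceil.
  have : (1 <= s)%N by rewrite divn_gt0 //; lia.
  by nia.
have nsd' : n%:R <= 8 * (s%:R * d%:R) :> R by rewrite -!natrM ler_nat.
(* For large [s * p] the tail is at least 1/2, which suffices because 168 j <= n. Otherwise [d]
   blocks of length [s] are asked for one success each. *)
have [sp6|sp6] := lerP 6 (s%:R * p).
  have hx : 0 <= p / 2 <= 1 by apply/andP; split; lra.
  have hc : 4 <= 1 + s%:R * (p / 2) by lra.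
  have := exp_compl_le hx (ltr0n _ 4) sdM hc => /= hle.
  have := tail_compl hp M d.
  have : 2 ^+ d * (1 - p / 2) ^+ M <= 2^-1 :> R.
    apply: (@le_trans _ _ (2 ^+ d * (4^-1) ^+ d)).
      by rewrite ler_wpM2l ?exprn_ge0.
    rewrite -exprMn (_ : 2 * 4^-1 = 2^-1); last by field.
    rewrite -[leRHS]expr1; apply: ler_wiXn2l => //; lra.
  have : 84 * j%:R / n%:R <= 2^-1 :> R.
    rewrite ler_pdivrMr //.
    have : (168 * j)%:R <= n%:R :> R by rewrite ler_nat.
    by rewrite natrM; lra.
  by move: (_ * _ ^+ M) (_ / _) => u v; lra.
apply: le_trans (tail_mono hp d sdM); apply: le_trans (tail_exp hp s d).
have sp0 : 0 <= s%:R * p by rewrite mulr_ge0 ?ler0n.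
have t1 : s%:R * p / 7 <= tail p s 1.
  rewrite tail_one; have := bernoulli_inv s hp.
  have : 0 <= (1 - p) ^+ s by rewrite exprn_ge0 ?subr_ge0.
  by move: sp0 sp6; move: (s%:R * p) (_ ^+ s) => u v; nra.
(* Here 448 * 336 = 7 * 8 * 4 * 672, with 7 from [t1], 8 from [nsd'] and 4 from the binomial bound.
   Then 672 = 8 * 84 turns j/(8n) into 84 j/n. *)
have t2 : 672 * (4 * n%:R * q' / d%:R) <= s%:R * p / 7.
  rewrite pE mulrA ler_pdivrMr //.
  by have := ler_wpM2r q0 nsd'; lra.
have z0 : 0 <= 4 * n%:R * q' / d%:R by rewrite !mulr_ge0 ?invr_ge0 ?ler0n.
apply: (@le_trans _ _ ((672 * (4 * n%:R * q' / d%:R)) ^+ d)); last first.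
  by rewrite lerXn2r ?nnegrE ?tail_ge0 ?(le_trans t2) // mulr_ge0.
rewrite exprMn; move: lb; set Z := _ ^+ d => lb.
have Z0 : 0 <= Z by rewrite exprn_ge0.
apply: (@le_trans _ _ (672 * Z)); last first.
  by rewrite ler_wpM2r // -[leLHS]expr1 ler_weXn2l // ler1n.
move: lb; rewrite ltr_pdivrMr ?mulr_gt0 // ler_pdivrMr //.
lra.
Qed.

(** Blocks of length [s = t %/ j] satisfy n <= 6 s j, so the constant 42 gives s x >= 7. Each of the
    [j] blocks contributes at most 1/8, against a factor 2. *)
Lemma potential_term n t j x : (0 < j)%N -> (168 * j <= n)%N -> (n <= 3 * t)%N ->
  0 <= x <= 1 -> 42 * j%:R / n%:R <= x ->
  2 ^+ j * (1 - x) ^+ t <= (4^-1) ^+ j.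
Proof.
move=> j0 jn nt hx lbx.
have n0' : (0 : R) < n%:R by rewrite ltr0n; lia.
have j0' : (0 : R) < j%:R by rewrite ltr0n.
pose s := (t %/ j)%N.
have sjt : (s * j <= t)%N by apply: leq_divM.
have nsj : (n <= 6 * (s * j))%N.
  have : (t < (s + 1) * j)%N by rewrite addn1 ltn_ceil.
  have : (1 <= s)%N by rewrite divn_gt0 //; lia.
  by nia.
have nsj' : n%:R <= 6 * (s%:R * j%:R) :> R by rewrite -!natrM ler_nat.
have hc : 8 <= 1 + s%:R * x.
  move: lbx; rewrite ler_pdivrMr // => lbx.
  have S0 : (0 : R) <= s%:R by rewrite ler0n.
  have := ler_wpM2l S0 lbx => h.
  have h7 : 7 * n%:R <= s%:R * x * n%:R by lra.
  by move: h7; rewrite ler_pM2r //; lra.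
have := exp_compl_le hx (ltr0n _ 8) sjt hc => /= hle.
apply: (@le_trans _ _ (2 ^+ j * (8^-1) ^+ j)).
  by rewrite ler_wpM2l ?exprn_ge0.
by rewrite -exprMn (_ : 2 * 8^-1 = 4^-1) //; field.
Qed.

End Estimates.

(** * Star forests in the random graph *)

Section LikelyStarForests.
Variable V : finType.
Implicit Types phi : V -> option V.

Lemma sum_fiber phi (C : {set V}) :
  (\sum_(c in C) #|fiber phi c| <= #|[set v | phi v]|)%N.
Proof.
have -> : (\sum_(c in C) #|fiber phi c| =
           \sum_(c in C) \sum_v (phi v == Some c))%N.
  apply: eq_bigr => c _; rewrite -sum1_card big_mkcond; apply: eq_bigr => v _.
  by rewrite inE; case: eqP.
rewrite exchange_big -sum1_card [leqRHS]big_mkcond; apply: leq_sum => v _.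
rewrite inE; case: (phi v) => [u|]; last by rewrite big1.
rewrite big_mkcond (bigD1 u) //= eqxx big1 ?addn0; first by case: ifP.
by move=> w wu; rewrite (inj_eq Some_inj) eq_sym (negPf wu) if_same.
Qed.

Lemma cross_edge_proof t m (i : 'I_t) (x : 'I_m) :
  #|[set lshift m i; rshift t x]| == 2%N.
Proof. by rewrite cards2 eq_lrshift. Qed.

(** The first [t] vertices are candidate centers and the last [m] are leaf positions; distinct pairs
    give distinct coordinates, as the greedy exposure requires. *)
Definition cross_edge t m (i : 'I_t) (x : 'I_m) : edge 'I_(t + m) :=
  exist _ [set lshift m i; rshift t x] (cross_edge_proof i x).

Lemma cross_edge_inj t m (i : 'I_t) (x : 'I_m) (i' : 'I_t) (x' : 'I_m) :
  cross_edge i x = cross_edge i' x' -> i = i' /\ x = x'.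
Proof.
move/(congr1 val) => /= ee; split.
  have : lshift m i \in [set lshift m i'; rshift t x'] by rewrite -ee set21.
  by rewrite !inE eq_lrshift orbF => /eqP/lshift_inj.
have : rshift t x \in [set lshift m i'; rshift t x'] by rewrite -ee set22.
by rewrite !inE eq_rlshift => /eqP/rshift_inj.
Qed.

Lemma packing_copy t m phi (cs : seq 'I_t) (A : {set edge 'I_(t + m)}) :
  star_map phi -> (#|V| <= t + m)%N -> (0 < m)%N ->
  packing (@cross_edge t m) (fun c => #|fiber phi c|) cs
    [set c | fiber phi c != set0] [set: 'I_m] A ->
  A \in copy_family (star_edges phi) (t + m).
Proof.
move=> star_phi cardV m0 [g [N [_ g_inj NY Ndisj NA]]].
set C := [set c | _] in g_inj NY Ndisj NA.
have inC v c : phi v = Some c -> c \in C.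
  by move=> vc; rewrite inE; apply/set0Pn; exists v; rewrite inE vc.
pose leaf_pos v c := nth (Ordinal m0) (enum (N c)) (index v (enum (fiber phi c))).
have lt_index v c : phi v = Some c ->
    (index v (enum (fiber phi c)) < size (enum (N c)))%N.
  move=> vc; have [_ cardN] := NY c (inC _ _ vc).
  by rewrite -cardE cardN cardE index_mem mem_enum inE vc.
have leaf_posN v c : phi v = Some c -> leaf_pos v c \in N c.
  by move=> vc; rewrite -mem_enum mem_nth ?lt_index.
(* The leaves of [c] are listed along [N c] and the centers follow [g]. The vertices outside [P],
   isolated in the star forest, are placed by [extend_injection]. *)
pose h v := if phi v is Some c then rshift t (leaf_pos v c) else lshift m (g v).
pose P := [set v | phi v || (v \in C)].
have inj_h : {in P &, injective h}.
  move=> v w; rewrite !inE /h.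
  case vc: (phi v) => [c|]; case wc: (phi w) => [c'|] //=.
  - move=> _ _ /rshift_inj ee; have [cc'|cc'] := eqVneq c c'; last first.
      have := Ndisj _ _ (inC _ _ vc) (inC _ _ wc) cc'.
      by rewrite disjoint_subset => /subsetP/(_ _ (leaf_posN _ _ vc));
        rewrite inE ee leaf_posN.
    subst c'; move/eqP: ee; rewrite nth_uniq ?lt_index ?enum_uniq // => /eqP.
    by move/(@index_inj _ v); apply; rewrite mem_enum inE ?vc ?wc.
  - by move=> _ _ /eqP; rewrite eq_rlshift.
  - by move=> _ _ /eqP; rewrite eq_lrshift.
  - move=> vC wC /lshift_inj; apply: g_inj; by rewrite inE.
have [|f inj_f fh] := extend_injection inj_h; first by rewrite card_ord.
apply/copy_familyP; exists f => //; apply/subsetP=> e /edge_imageP[e'].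
case/star_edgesP=> v [c [vc e'E]] eE.
have cC := inC _ _ vc.
have fv : f v = rshift t (leaf_pos v c) by rewrite fh ?inE ?vc // /h vc.
have fc : f c = lshift m (g c).
  rewrite fh ?[c \in P]inE ?cC ?orbT //.
  by rewrite /h (star_phi _ _ vc).
have -> : e = cross_edge (g c) (leaf_pos v c).
  by apply: val_inj; rewrite eE e'E imsetU1 imset_set1 fv fc setUC.
exact: NA (leaf_posN _ _ vc).
Qed.

Lemma mu_star_forest (R : realType) phi (H : {set edge V}) n (q' : R) :
  star_map phi -> star_edges phi \subset H -> (#|V| <= n)%N -> (168 <= n)%N ->
  (168 * #|[set v | phi v]| <= n)%N -> 0 <= q' <= 1 ->
  448 * 336 * q' <= 1 -> ~ psmall q' (copy_family H n) ->
  2^-1 < mu (448 * 336 * q') (copy_family (star_edges phi) n).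
Proof.
move=> star_phi phiH cardV n_ge leaves hq' p1 not_small.
set p := 448 * 336 * q'.
have /andP[q0 q1] := hq'.
have hp : 0 <= p <= 1 by rewrite p1 andbT /p; lra.
(* About half of the vertices are candidate centers. At most n/168 of the leaf positions get used,
   so at least [M] of them, a quarter of [n], always stay free. *)
pose t := n./2; pose m := (n - t)%N.
have nE : n = (t + m)%N by rewrite /m /t; clear; lia.
have nt : (n <= 3 * t)%N by rewrite /t; move: n_ge; clear; lia.
have t0 : (0 < t)%N by rewrite /t; move: n_ge; clear; lia.
pose l := #|[set v | phi v]|; pose M := (m - l)%N.
have nM : (n <= 4 * M)%N by rewrite /M /m /t /l; move: n_ge leaves; clear; lia.
have lm : (l <= m)%N by rewrite /m /t /l; move: n_ge leaves; clear; lia.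
have m0 : (0 < m)%N by rewrite /m /t; move: n_ge; clear; lia.
pose d c := #|fiber phi c|; pose C := [set c | fiber phi c != set0].
have dC c : c \in C -> (0 < d c)%N by rewrite inE card_gt0.
have fail_le : mu p [set A | `[< ~ packing (@cross_edge t m) d (enum 'I_t) C
    [set: 'I_m] A >]] <= 3^-1.
  have cardY : (M + \sum_(c in C) d c <= #|[set: 'I_m]|)%N.
    rewrite cardsT card_ord; have := sum_fiber phi C; rewrite -/l => ?.
    by rewrite -[leqRHS](subnK lm) leq_add2l.
  have := packing_fail hp (@cross_edge_inj t m) (Ordinal t0)
    (enum_uniq 'I_t) cardY.
  move=> /le_trans; apply; rewrite size_enum_ord.
  apply: (@le_trans _ _ (\sum_(c in C) (4^-1) ^+ rank d C c)).
    apply: ler_sum => c cC; set j := rank d C c.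
    (* The [j] stars at least as large as the one at [c] have at least [d c] leaves each, so
       [expectation_bound] applies to them. Their total size bounds both [j] and [d c] by n/168. *)
    pose Cc := [set c' in C | (d c <= d c')%N].
    have j0 : (0 < j)%N by apply/card_gt0P; exists c; rewrite inE cC /=.
    have jd : (j * d c <= l)%N.
      apply: leq_trans (sum_fiber phi Cc); rewrite -sum_nat_const.
      by apply: leq_sum => c'; rewrite inE => /andP[].
    have jl : (168 * j <= n)%N.
      apply: leq_trans leaves; rewrite leq_mul2l /=.
      exact: leq_trans (leq_pmulr _ (dC c cC)) jd.
    have dl : (168 * d c <= n)%N.
      apply: leq_trans leaves; rewrite leq_mul2l /=.
      exact: leq_trans (leq_pmull _ j0) jd.
    have dCc : {in Cc, forall c', (d c <= #|fiber phi c'|)%N}.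
      by move=> c'; rewrite inE => /andP[].
    have n0 : (0 < n)%N by apply: leq_trans n_ge.
    have lb := expectation_bound star_phi phiH dCc hq' not_small.
    have := tail_lower hp q0 erefl (dC c cC) dl nM jl
      (expectation_bound_le n0 (dC c cC) j0 q0 lb).
    have := tail_bounds hp M (d c).
    move: (tail p M (d c)) => T /andP[T0 T1] lbT.
    clear -T0 T1 lbT j0 jl nt; apply: (potential_term j0 jl nt).
      by apply/andP; split; lra.
    by move: lbT; rewrite -!mulrA; move: (_ / n%:R) => u; lra.
  (* The geometric series of ratio 1/4 sums to at most 1/3, so a copy appears with probability at
     least 2/3. *)
  have h4 : 0 <= (4^-1 : R) <= 1 by rewrite invr_ge0 ler0n invf_le1 ?ler1n ?ltr0n.
  have := sum_exp_rank d C h4.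
  have : (0 : R) <= (4^-1) ^+ #|C| by rewrite exprn_ge0 ?invr_ge0 ?ler0n.
  by move: (\sum_(_ in _) _) (_ ^+ _) => u v; lra.
have : 1 - mu p (copy_family (star_edges phi) (t + m)) <= 3^-1.
  rewrite -mu_setC; apply: le_trans fail_le; rewrite !mu_expect.
  apply: expect_le => // A; rewrite in_setC ler_nat.
  have [//|ncopy] := boolP (A \in _); rewrite lt0b in_set; apply/asboolP=> packA.
  by case/negP: ncopy; apply: packing_copy star_phi _ m0 packA; rewrite -nE.
by rewrite nE; lra.
Qed.

End LikelyStarForests.

(** * Cutting into small star forests, and conclusion *)

Lemma star_forest_cover (V : finType) (H : {set edge V}) (D n : nat) :
  (degen H <= D)%N -> (#|V| <= n)%N -> (336 <= n)%N ->
  exists phi : 'I_D * bool * 'I_336 -> V -> option V,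
  [/\ forall i, star_map (phi i), forall i, star_edges (phi i) \subset H,
      forall i, (168 * #|[set v | phi i v]| <= n)%N &
      H \subset \bigcup_i star_edges (phi i)].
Proof.
move=> degD cardV n_ge.
have [pi [par [par_pi piH Hpi]]] := degenerate_decomposition degD.
pose s := (n %/ 168)%N.
have s0 : (0 < s)%N by rewrite divn_gt0 // (leq_trans _ n_ge).
(* Rounding n/168 down to [s] loses at most a factor 2, whence 336 = 2 * 168 chunks. *)
have ns : (n <= 336 * s)%N.
  have : (n < (s + 1) * 168)%N by rewrite addn1 ltn_ceil.
  by move: s0; clear; lia.
pose chunk (v : V) := (enum_rank v %/ s)%N.
have chunk_lt v : (chunk v < 336)%N.
  by rewrite ltn_divLR // (leq_trans (ltn_ord _)) // (leq_trans cardV).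
(* A piece fixes the index, the parity of the leaf and its chunk. Centers have the opposite parity,
   so they are not leaves of the same piece. *)
pose phi (i : 'I_D * bool * 'I_336) v :=
  if (par i.1.1 v == i.1.2) && (chunk v == i.2) then pi i.1.1 v else None.
have phi_pi i v u : phi i v = Some u ->
    [/\ par i.1.1 v = i.1.2, chunk v = i.2 & pi i.1.1 v = Some u].
  by rewrite /phi; case: ifP => // /andP[/eqP-> /eqP->].
exists phi; split.
- move=> i v u /phi_pi[pv _ piv]; rewrite /phi (par_pi _ _ _ piv) pv.
  by case: (i.1.2).
- move=> i; apply/subsetP=> e /star_edgesP[v [u [/phi_pi[_ _ piv] eE]]].
  have [e' e'H e'E] := piH _ _ _ piv.
  by rewrite (_ : e = e') //; apply: val_inj; rewrite eE e'E.
- move=> i; apply: (@leq_trans (168 * s)); last by rewrite mulnC leq_divM.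
  (* Within a chunk the rank modulo [s] determines the vertex, so a piece has at most [s] leaves. *)
  rewrite leq_mul2l /=; pose f (v : V) : 'I_s := Ordinal (ltn_pmod (enum_rank v) s0).
  rewrite -[leqRHS]card_ord -(@card_in_imset _ _ f) ?max_card // => v w.
  rewrite !inE; case vu: (phi i v) => [u|//]; case ww: (phi i w) => [u'|//] _ _.
  move/(congr1 val) => /= vw; apply: enum_rank_inj; apply: ord_inj.
  have [_ cv _] := phi_pi _ _ _ vu; have [_ cw _] := phi_pi _ _ _ ww.
  rewrite (divn_eq (enum_rank v) s) (divn_eq (enum_rank w) s) vw.
  by rewrite -[(enum_rank v %/ s)%N]/(chunk v) cv -cw.
apply/subsetP=> e eH; have [i [v [u [piv eE]]]] := Hpi e eH.
apply/bigcupP; exists (i, par i v, Ordinal (chunk_lt v)) => //.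
by apply/star_edgesP; exists v, u; rewrite /phi /= !eqxx.
Qed.

Lemma threshold_le1 (R : realType) (X : finType) k (I : {set {set X}}) :
  threshold R k I <= 1.
Proof.
rewrite /threshold; set E := [set _ | _]%classic.
have [->|/set0P[p Ep]] := eqVneq E classical_sets.set0.
  by rewrite inf0 ler01.
apply: (@le_trans _ _ p); last by case: Ep => /andP[].
by apply: ge_inf => //; exists 0 => x [/andP[]].
Qed.

Lemma not_psmall (R : realType) (X : finType) (I : {set {set X}}) (p : R) :
  0 <= p <= 1 -> expectation_threshold R I < p -> ~ psmall p I.
Proof.
move=> hp lt_p small; move: lt_p; rewrite ltNge => /negP; apply.
by apply: ub_le_sup; [exists 1 => x [/andP[]] | split].
Qed.

Theorem theorem1p12 (R : realType) (D : nat) (hD : (0 < D)%N) :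
  exists (k : nat) (L : R), (0 < k)%N /\
    exists N : nat, forall n : nat, (N <= n)%N ->
      forall (V : finType) (H : {set edge V}),
        (#|V| <= n)%N -> (degen H <= D)%N ->
        pk R n k H <= L * q R n H.
Proof.
have k0 : (0 < #|{: 'I_D * bool * 'I_336}|)%N.
  by rewrite !card_prod !card_ord card_bool !muln_gt0 hD.
exists #|{: 'I_D * bool * 'I_336}|, (448 * 336); split=> //.
exists 336%N => n n_ge V H cardV degD; rewrite /pk /q.
have [_|H0] := eqVneq H set0; first by rewrite mulr0.
set Q := expectation_threshold _ _.
have [/andP[Q0 Q1] _] : 0 <= Q <= 1 /\ psmall Q (copy_family H n).
  apply: expectation_threshold_max; apply/negP=> /copy_familyP[f inj_f].
  by rewrite subset0 -cards_eq0 card_edge_image // cards_eq0 (negPf H0).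
have [phi [star_phi phiH leaves Hphi]] := star_forest_cover degD cardV n_ge.
(* The slack [eps] gives room for some [q'] above [Q], where the family is not [q']-small. *)
apply/ler_addgt0Pr => eps eps0.
pose q' := Q + eps / (448 * 336).
have q'Q : Q < q' by rewrite ltrDl divr_gt0 // mulr_gt0 ?ltr0n.
have -> : 448 * 336 * Q + eps = 448 * 336 * q' by rewrite /q'; field.
have [p1|p1] := leP 1 (448 * 336 * q').
  exact: le_trans (threshold_le1 _ _ _) p1.
have hq' : 0 <= q' <= 1 by apply/andP; split; lra.
have not_small := not_psmall hq' q'Q.
apply: (threshold_le _ cardV k0 Hphi) => [|i].
  by apply/andP; split; lra.
apply: (mu_star_forest (star_phi i) (phiH i)) => //; last exact: ltW.
exact: leq_trans n_ge.
Qed.
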